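(* Let $\mathbb A$ be a distributive monoidal category and consider the category $\mathbf H\,\ulcorner\mathbb A\urcorner^{*}$ of horizontal cells of its free cornering with iteration. For all objects $U$ of $\mathbf H\,\ulcorner\mathbb A\urcorner^{*}$: (i) $(U^\times,\ id_{U^\times}:U^\times\to U^\times=I\times(U\otimes U^\times))$ is the final coalgebra of the functor $I\times(U\otimes-):\mathbf H\,\ulcorner\mathbb A\urcorner^{*}\to\mathbf H\,\ulcorner\mathbb A\urcorner^{*}$; (ii) $(U^+,\ id_{U^+}:I+(U\otimes U^+)=U^+\to U^+)$ is the initial algebra of the functor $I+(U\otimes-):\mathbf H\,\ulcorner\mathbb A\urcorner^{*}\to\mathbf H\,\ulcorner\mathbb A\urcorner^{*}$.
   Context: Monoidal categories are strict, and composites are in diagrammatic order ($fg$ is first $f$, then $g$). A single-object double category $\mathbb D$ has a horizontal edge monoid $(\mathbb D_H,\otimes,I)$, a vertical edge monoid $(\mathbb D_V,\otimes,I)$, and for $A,B\in\mathbb D_H$, $U,W\in\mathbb D_V$ a set of cells $(U;A;B;W)$ (left; top; bottom; right boundary). For $\alpha:(U;A;B;V)$ and $\beta:(V;A';B';W)$ there is a horizontal composite $\alpha\mid\beta:(U;A\otimes A';B\otimes B';W)$; for $\alpha:(U;A;C;W)$ and $\beta:(U';C;B;W')$ a vertical composite $\frac{\alpha}{\beta}:(U\otimes U';A;B;W\otimes W')$. Both are associative and unital, with horizontal units $id_U:(U;I;I;U)$ and vertical units $1_A:(I;A;A;I)$, where $id_I=1_I$, $1_{A\otimes B}=1_A\mid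 1_B$, $id_{U\otimes W}=\frac{id_U}{id_W}$, and interchange $\frac{\alpha}{\beta}\mid\frac{\gamma}{\delta}=\frac{\alpha\mid\gamma}{\beta\mid\delta}$ holds. $\mathbf H\,\mathbb D$ is the monoidal category with objects the elements of $\mathbb D_V$, morphisms $U\to W$ the cells $(U;I;I;W)$, composition $\mid$, and tensor given by vertical composition. A distributive monoidal category $(\mathbb A,\otimes,\oplus,I)$ is a symmetric monoidal category with binary coproducts $A\oplus B$ (injections $\sigma_0,\sigma_1$, copairing $[f,g]$; no initial object required) such that $[\sigma_0\otimes 1_C,\sigma_1\otimes 1_C]:(A\otimes C)\oplus(B\otimes C)\to(A\oplus B)\otimes C$ is invertible for all $A,B,C$. Exchanges with iteration: $\mathbb A^{\circ\bullet}_*$ is the monoid (operation $\otimes$, unit $I$) with elements generated by $A^\circ$, $A^\bullet$ ($A\in\mathbb A_0$), $I$, $U\otimes W$, $U\times W$, $U+W$, $U^\times$, $U^+$, subject to associativity and unitality of $\otimes$ and the equations $U^\times=I\times(U\otimes U^\times)$, $U^+=I+(U\otimes U^+)$. Free cornering with iteration: $\ulcorner\mathbb A\urcorner^{*}$ is the free single-object double category with horizontal edge monoid $(\mathbb A_0,\otimes,I)$, vertical edge monoid $\mathbb A^{\circ\bullet}_*$, and generating cells and equations: (1) for each $f:A\to B$ in $\mathbb A$ a cell $\ulcorner f\urcorner:(I;A;B;I)$ (also written $f$), with $\ulcorner fg\urcorner=\frac{\ulcorner f\urcorner}{\ulcorner g\urcorner}$, $\ulcorner 1_A\urcorner=1_A$,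 $\ulcorner f\otimes g\urcorner=\ulcorner f\urcorner\mid\ulcorner g\urcorner$; (2) for each $A\in\mathbb A_0$ corner cells $\mathsf{get}_L^A:(A^\circ;I;A;I)$, $\mathsf{put}_R^A:(I;A;I;A^\circ)$, $\mathsf{get}_R^A:(I;I;A;A^\bullet)$, $\mathsf{put}_L^A:(A^\bullet;A;I;I)$ with $\mathsf{put}_R^A\mid\mathsf{get}_L^A=1_A$, $\frac{\mathsf{get}_L^A}{\mathsf{put}_R^A}=id_{A^\circ}$, $\mathsf{get}_R^A\mid\mathsf{put}_L^A=1_A$, $\frac{\mathsf{get}_R^A}{\mathsf{put}_L^A}=id_{A^\bullet}$; (3) for all $U,W$, cells $\pi_0:(U\times W;I;I;U)$, $\pi_1:(U\times W;I;I;W)$, and for $\alpha:(V;A;B;U)$, $\beta:(V;A;B;W)$ a unique cell $\alpha\times\beta:(V;A;B;U\times W)$ with $(\alpha\times\beta)\mid\pi_0=\alpha$, $(\alpha\times\beta)\mid\pi_1=\beta$; (4) for all $U,W$, cells $\iota_0:(U;I;I;U+W)$, $\iota_1:(W;I;I;U+W)$, and for $\alpha:(U;A;B;V)$, $\beta:(W;A;B;V)$ a unique cell $\alpha+\beta:(U+W;A;B;V)$ with $\iota_0\mid(\alpha+\beta)=\alpha$, $\iota_1\mid(\alpha+\beta)=\beta$; (5) for $\alpha:(U;A;C;W)$, $\beta:(U;B;C;W)$ a unique cell $[\alpha,\beta]:(U;A\oplus B;C;W)$ with $\frac{\ulcorner\sigma_0\urcorner}{[\alpha,\beta]}=\alpha$,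 $\frac{\ulcorner\sigma_1\urcorner}{[\alpha,\beta]}=\beta$; (6) for $\alpha:(V;A;A;U)$, $f:(W;A;B;K)$, $g:(W;I;I;V\otimes W)$ a unique cell $\alpha^\times_{f,g}:(W;A;B;U^\times\otimes K)$ with $\alpha^\times_{f,g}\mid\frac{\pi_0}{id_K}=f$ and $\alpha^\times_{f,g}\mid\frac{\pi_1}{id_K}=g\mid\frac{\alpha}{\alpha^\times_{f,g}}$; (7) for $\alpha:(U;A;A;V)$, $f:(K;A;B;W)$, $g:(V\otimes W;I;I;W)$ a unique cell $\alpha^+_{f,g}:(U^+\otimes K;A;B;W)$ with $\frac{\iota_0}{id_K}\mid\alpha^+_{f,g}=f$ and $\frac{\iota_1}{id_K}\mid\alpha^+_{f,g}=\frac{\alpha}{\alpha^+_{f,g}}\mid g$. Here $\pi_0:U^\times\to I$, $\pi_1:U^\times\to U\otimes U^\times$, $\iota_0:I\to U^+$, $\iota_1:U\otimes U^+\to U^+$ are the projections/injections of $U^\times=I\times(U\otimes U^\times)$ and $U^+=I+(U\otimes U^+)$. The functor $I\times(U\otimes-)$ sends $h:W\to W'$ to $\pi_0\times\left(\pi_1\mid\frac{id_U}{h}\right)$; $I+(U\otimes-)$ sends $h$ to $\iota_0+\left(\frac{id_U}{h}\mid\iota_1\right)$. *)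

(* Defs.v *)
From HB Require Import structures.
From mathcomp Require Import all_boot monoid.
From mathcomp Require Import boolp.

Set Implicit Arguments.
Unset Strict Implicit.
Unset Printing Implicit Defensive.

Local Open Scope group_scope.
Local Open Scope quotient_scope.

(* Objects and edges form strict monoids (monoidType; its choiceType part is no
   restriction classically), so arrows and cells live in families indexed by
   elements that are equal without being convertible.  [hcast] and [bcast]
   transport along such equalities, and [f =~ g], [a =~~ b] say that the two
   sides have equal boundaries and are equal after that transport; boundary
   equalities being proof-irrelevant, this is the usual equality of arrows and
   of cells. *)

Section Casts.

Definition hcast (T : Type) (P : T -> T -> Type) X X' Y Y'
    (eX : X = X') (eY : Y = Y') (f : P X Y) : P X' Y' :=
  ecast y (P X' y) eY (ecast x (P x Y) eX f).

Definition heq (T : Type) (P : T -> T -> Type) X X' Y Y'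
    (f : P X Y) (g : P X' Y') : Prop :=
  exists (eX : X = X') (eY : Y = Y'), hcast eX eY f = g.

Definition bcast (V H : Type) (P : V -> H -> H -> V -> Type)
    U U' X X' Y Y' W W' (eU : U = U') (eX : X = X') (eY : Y = Y') (eW : W = W')
    (a : P U X Y W) : P U' X' Y' W' :=
  ecast w (P U' X' Y' w) eW (ecast y (P U' X' y W) eY
    (ecast x (P U' x Y W) eX (ecast u (P u X Y W) eU a))).

Definition beq (V H : Type) (P : V -> H -> H -> V -> Type)
    U U' X X' Y Y' W W' (a : P U X Y W) (b : P U' X' Y' W') : Prop :=
  exists (eU : U = U') (eX : X = X') (eY : Y = Y') (eW : W = W'),
    bcast eU eX eY eW a = b.

End Casts.

Arguments hcast {T} P {X X' Y Y'} eX eY f.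
Arguments heq {T} P {X X' Y Y'} f g.
Arguments bcast {V H} P {U U' X X' Y Y' W W'} eU eX eY eW a.
Arguments beq {V H} P {U U' X X' Y Y' W W'} a b.

Section CastTheory.
Variables (V H : Type) (P : V -> H -> H -> V -> Type).

Lemma beq_refl U X Y W (a : P U X Y W) : beq P a a.
Proof. by exists erefl, erefl, erefl, erefl. Qed.

Lemma beq_sym U X Y W U' X' Y' W' (a : P U X Y W) (b : P U' X' Y' W') :
  beq P a b -> beq P b a.
Proof.
move=> [eU [eX [eY [eW]]]]; case: _ / eU b; case: _ / eX; case: _ / eY.
by case: _ / eW => b <-; exact: beq_refl.
Qed.

Lemma beq_trans U X Y W U' X' Y' W' U2 X2 Y2 W2
    (a : P U X Y W) (b : P U' X' Y' W') (c : P U2 X2 Y2 W2) :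
  beq P a b -> beq P b c -> beq P a c.
Proof.
move=> [eU [eX [eY [eW]]]]; case: _ / eU b; case: _ / eX; case: _ / eY.
by case: _ / eW => b <-.
Qed.

Lemma beq_eq U X Y W (a b : P U X Y W) : beq P a b -> a = b.
Proof.
move=> [eU [eX [eY [eW]]]].
by rewrite (Prop_irrelevance eU erefl) (Prop_irrelevance eX erefl)
  (Prop_irrelevance eY erefl) (Prop_irrelevance eW erefl).
Qed.

Lemma beq_cast U X Y W U' X' Y' W'
    (eU : U = U') (eX : X = X') (eY : Y = Y') (eW : W = W') (a : P U X Y W) :
  beq P (bcast P eU eX eY eW a) a.
Proof. by apply: beq_sym; exists eU, eX, eY, eW. Qed.

End CastTheory.

(* Composites are in diagrammatic order throughout. *)

Record category (O : Type) := Category {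
  hom : O -> O -> Type;
  idm : forall X, hom X X;
  mcomp : forall X Y Z, hom X Y -> hom Y Z -> hom X Z;
  mcomp1m : forall X Y (f : hom X Y), mcomp (idm X) f = f;
  mcompm1 : forall X Y (f : hom X Y), mcomp f (idm Y) = f;
  mcompA : forall X Y Z T (f : hom X Y) (g : hom Y Z) (h : hom Z T),
    mcomp f (mcomp g h) = mcomp (mcomp f g) h
}.
Arguments hom {O} c X Y.
Arguments idm {O c} X.
Arguments mcomp {O c X Y Z} f g.

Notation "f \; g" := (mcomp f g) : cat_scope.
Notation "f =~ g" := (heq (hom _) f g) (at level 70, no associativity) : cat_scope.
Delimit Scope cat_scope with cat.
Local Open Scope cat_scope.

Definition is_iso (O : Type) (C : category O) X Y (f : hom C X Y) : Prop :=
  exists g : hom C Y X, f \; g = idm X /\ g \; f = idm Y.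

(* The identity of X regarded as an arrow X -> Y along X = Y. *)
Definition eq_hom (O : Type) (C : category O) X Y (e : X = Y) : hom C X Y :=
  hcast (hom C) erefl e (idm X).
Arguments eq_hom {O} C {X Y} e.

Record functor (O O' : Type) (C : category O) (D : category O') := Functor {
  fobj :> O -> O';
  fmap : forall X Y, hom C X Y -> hom D (fobj X) (fobj Y);
  fmap_id : forall X, fmap (idm X) = idm (fobj X);
  fmap_comp : forall X Y Z (f : hom C X Y) (g : hom C Y Z),
    fmap (f \; g) = fmap f \; fmap g
}.
Arguments fmap {O O' C D} _ {X Y} _.

Definition is_final_coalgebra (O : Type) (C : category O) (F : functor C C)
    (X : O) (a : hom C X (F X)) : Prop :=
  forall (Y : O) (b : hom C Y (F Y)),
    exists! h : hom C Y X, h \; a = b \; fmap F h.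

Definition is_initial_algebra (O : Type) (C : category O) (F : functor C C)
    (X : O) (a : hom C (F X) X) : Prop :=
  forall (Y : O) (b : hom C (F Y) Y),
    exists! h : hom C X Y, a \; h = fmap F h \; b.

Record strict_monoidal (O : monoidType) := StrictMonoidal {
  smcat :> category O;
  tens : forall X Y X' Y', hom smcat X Y -> hom smcat X' Y' ->
    hom smcat (X * X') (Y * Y');
  tens_id : forall X Y, tens (idm X) (idm Y) = idm (X * Y);
  tens_comp : forall X Y Z X' Y' Z' (f : hom smcat X Y) (g : hom smcat Y Z)
      (f' : hom smcat X' Y') (g' : hom smcat Y' Z'),
    tens (f \; g) (f' \; g') = tens f f' \; tens g g';
  tensA : forall X Y X' Y' X2 Y2 (f : hom smcat X Y) (g : hom smcat X' Y')
      (h : hom smcat X2 Y2),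
    tens f (tens g h) =~ tens (tens f g) h;
  tens1m : forall X Y (f : hom smcat X Y), tens (idm 1) f =~ f;
  tensm1 : forall X Y (f : hom smcat X Y), tens f (idm 1) =~ f
}.
Arguments tens {O s X Y X' Y'} f g.

(* braid X 1 =~ idm X follows from braidM and braidK. *)
Record symmetric_monoidal (O : monoidType) := SymmetricMonoidal {
  symcat :> strict_monoidal O;
  braid : forall X Y, hom symcat (X * Y) (Y * X);
  braid_nat : forall X Y X' Y' (f : hom symcat X Y) (g : hom symcat X' Y'),
    tens f g \; braid Y Y' = braid X X' \; tens g f;
  braidK : forall X Y, braid X Y \; braid Y X = idm (X * Y);
  (* the middle object of the right-hand side is (Y * X) * Z = Y * (X * Z) *)
  braidM : forall X Y Z, braid X (Y * Z) =~
    hcast (hom symcat) erefl (esym (mulgA Y X Z)) (tens (braid X Y) (idm Z))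
      \; tens (idm Y) (braid X Z)
}.

Record distributive_monoidal (O : monoidType) := DistributiveMonoidal {
  distcat :> symmetric_monoidal O;
  oplus : O -> O -> O;
  inj0 : forall X Y, hom distcat X (oplus X Y);
  inj1 : forall X Y, hom distcat Y (oplus X Y);
  copair : forall X Y Z, hom distcat X Z -> hom distcat Y Z ->
    hom distcat (oplus X Y) Z;
  inj0_copair : forall X Y Z (f : hom distcat X Z) (g : hom distcat Y Z),
    inj0 X Y \; copair f g = f;
  inj1_copair : forall X Y Z (f : hom distcat X Z) (g : hom distcat Y Z),
    inj1 X Y \; copair f g = g;
  copair_uniq : forall X Y Z (f : hom distcat X Z) (g : hom distcat Y Z) h,
    inj0 X Y \; h = f -> inj1 X Y \; h = g -> h = copair f g;
  distr_iso : forall X Y Z,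
    is_iso (copair (tens (inj0 X Y) (idm Z)) (tens (inj1 X Y) (idm Z)))
}.
Arguments oplus {O d} X Y.
Arguments inj0 {O d} X Y.
Arguments inj1 {O d} X Y.
Arguments copair {O d X Y Z} f g.

(* [cell U X Y W]: left boundary U, top X, bottom Y, right W.  [hcomp] pastes side
   by side and [vcomp] pastes the first cell above the second. *)
Record double_category (H V : monoidType) := DoubleCategory {
  cell : V -> H -> H -> V -> Type;
  hid : forall U, cell U 1 1 U;
  vid : forall X, cell 1 X X 1;
  hcomp : forall U X Y V' X' Y' W,
    cell U X Y V' -> cell V' X' Y' W -> cell U (X * X') (Y * Y') W;
  vcomp : forall U X Z W U' Y W',
    cell U X Z W -> cell U' Z Y W' -> cell (U * U') X Y (W * W');
  hcompA : forall U0 U1 U2 U3 X Y X' Y' X2 Y2 (a : cell U0 X Y U1)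
      (b : cell U1 X' Y' U2) (c : cell U2 X2 Y2 U3),
    beq cell (hcomp a (hcomp b c)) (hcomp (hcomp a b) c);
  hcomp1c : forall U X Y W (a : cell U X Y W), beq cell (hcomp (hid U) a) a;
  hcompc1 : forall U X Y W (a : cell U X Y W), beq cell (hcomp a (hid W)) a;
  vcompA : forall X0 X1 X2 X3 U W U' W' U2 W2 (a : cell U X0 X1 W)
      (b : cell U' X1 X2 W') (c : cell U2 X2 X3 W2),
    beq cell (vcomp a (vcomp b c)) (vcomp (vcomp a b) c);
  vcomp1c : forall U X Y W (a : cell U X Y W), beq cell (vcomp (vid X) a) a;
  vcompc1 : forall U X Y W (a : cell U X Y W), beq cell (vcomp a (vid Y)) a;
  hid1 : hid 1 = vid 1;
  vidM : forall X Y, vid (X * Y) = hcomp (vid X) (vid Y);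
  hidM : forall U W, hid (U * W) = vcomp (hid U) (hid W);
  interchange : forall U V' W X Z Y U' V2 W' X' Z' Y'
      (a : cell U X Z V') (b : cell U' Z Y V2)
      (c : cell V' X' Z' W) (d : cell V2 Z' Y' W'),
    hcomp (vcomp a b) (vcomp c d) = vcomp (hcomp a c) (hcomp b d)
}.
Arguments hid {H V _} U.
Arguments vid {H V _} X.
Arguments hcomp {H V _ U X Y V' X' Y' W} a b.
Arguments vcomp {H V _ U X Z W U' Y W'} a b.

Notation "a <|> b" := (hcomp a b) (at level 40, left associativity) : cell_scope.
Notation "a </> b" := (vcomp a b) (at level 40, left associativity) : cell_scope.
Notation "a =~~ b" := (beq (cell _) a b) (at level 70, no associativity) : cell_scope.
Delimit Scope cell_scope with cell.
Local Open Scope cell_scope.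

Section HorizontalCategory.
Variables (H V : monoidType) (D : double_category H V).
Implicit Types (U W : V).

Lemma beq_hcomp U X Y W X' Y' K U2 X2 Y2 W2 X2' Y2' K2
    (a : cell D U X Y W) (b : cell D W X' Y' K)
    (a' : cell D U2 X2 Y2 W2) (b' : cell D W2 X2' Y2' K2) :
  a =~~ a' -> b =~~ b' -> a <|> b =~~ a' <|> b'.
Proof.
case=> eU [eX [eY [eW]]]; case: _ / eW b' a' => b' a'.
case: _ / eU a'; case: _ / eX; case: _ / eY => a' <- {a'} /=.
case=> eU [eX' [eY' [eW]]]; rewrite (Prop_irrelevance eU erefl) => {eU}.
by case: _ / eX' b'; case: _ / eY'; case: _ / eW => b' <-; exact: beq_refl.
Qed.

Lemma beq_vcomp U X Z W U' Y W' U2 X2 Z2 W2 U2' Y2 W2'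
    (a : cell D U X Z W) (b : cell D U' Z Y W')
    (a' : cell D U2 X2 Z2 W2) (b' : cell D U2' Z2 Y2 W2') :
  a =~~ a' -> b =~~ b' -> a </> b =~~ a' </> b'.
Proof.
case=> eU [eX [eY [eW]]]; case: _ / eY b' a' => b' a'.
case: _ / eU a'; case: _ / eX; case: _ / eW => a' <- {a'} /=.
case=> eU' [eX [eY' [eW']]]; rewrite (Prop_irrelevance eX erefl) => {eX}.
by case: _ / eU' b'; case: _ / eY'; case: _ / eW' => b' <-; exact: beq_refl.
Qed.

Definition hor_hom U W := cell D U 1 1 W.

(* a <|> b has top and bottom boundary 1 * 1 = 1 *)
Definition hor_comp U W K (a : hor_hom U W) (b : hor_hom W K) : hor_hom U K :=
  bcast (cell D) erefl (mulg1 1) (mulg1 1) erefl (a <|> b).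

Lemma hor_compE U W K (a : hor_hom U W) (b : hor_hom W K) :
  hor_comp a b =~~ a <|> b.
Proof. exact: beq_cast. Qed.

Lemma hor_comp1m U W (a : hor_hom U W) : hor_comp (hid U) a = a.
Proof. exact: beq_eq (beq_trans (hor_compE _ _) (hcomp1c _)). Qed.

Lemma hor_compm1 U W (a : hor_hom U W) : hor_comp a (hid W) = a.
Proof. exact: beq_eq (beq_trans (hor_compE _ _) (hcompc1 _)). Qed.

Lemma hor_compA U W K L (a : hor_hom U W) (b : hor_hom W K) (c : hor_hom K L) :
  hor_comp a (hor_comp b c) = hor_comp (hor_comp a b) c.
Proof.
apply: beq_eq; apply: beq_trans (hor_compE _ _) _.
apply: beq_trans (beq_hcomp (beq_refl _) (hor_compE _ _)) _.
apply: beq_trans (hcompA _ _ _) _; apply: beq_sym.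
apply: beq_trans (hor_compE _ _) _.
exact: beq_hcomp (hor_compE _ _) (beq_refl _).
Qed.

Definition hor_category : category V :=
  Category hor_comp1m hor_compm1 hor_compA.

Lemma beq_heq U W U' W' (a : hor_hom U W) (b : hor_hom U' W') :
  a =~~ b -> heq hor_hom a b.
Proof.
move=> [eU [eX [eY [eW]]]]; case: _ / eU b; case: _ / eW => b.
rewrite (Prop_irrelevance eX erefl) (Prop_irrelevance eY erefl) => <-.
by exists erefl, erefl.
Qed.

Definition hor_tens U W U' W' (a : hom hor_category U W)
    (b : hom hor_category U' W') : hom hor_category (U * U') (W * W') :=
  vcomp a b.

Lemma hor_tens_id U W :
  hor_tens (idm U) (idm W) = idm (c := hor_category) (U * W).
Proof. by rewrite /hor_tens /= hidM. Qed.

Lemma hor_tens_comp U W K U' W' K' (a : hom hor_category U W)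
    (b : hom hor_category W K) (a' : hom hor_category U' W')
    (b' : hom hor_category W' K') :
  hor_tens (a \; b) (a' \; b') = hor_tens a a' \; hor_tens b b'.
Proof.
apply: beq_eq; rewrite /hor_tens /=.
apply: beq_trans (beq_vcomp (hor_compE _ _) (hor_compE _ _)) _.
by apply: beq_sym; apply: beq_trans (hor_compE _ _) _; rewrite interchange;
  exact: beq_refl.
Qed.

Lemma hor_tensA U W U' W' U2 W2 (a : hom hor_category U W)
    (b : hom hor_category U' W') (c : hom hor_category U2 W2) :
  hor_tens a (hor_tens b c) =~ hor_tens (hor_tens a b) c.
Proof. exact/beq_heq/vcompA. Qed.

Lemma hor_tens1m U W (a : hom hor_category U W) : hor_tens (idm 1) a =~ a.
Proof. by apply: beq_heq; rewrite /hor_tens /= hid1; exact: vcomp1c. Qed.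

Lemma hor_tensm1 U W (a : hom hor_category U W) : hor_tens a (idm 1) =~ a.
Proof. by apply: beq_heq; rewrite /hor_tens /= hid1; exact: vcompc1. Qed.

Definition horizontal : strict_monoidal V :=
  StrictMonoidal hor_tens_id hor_tens_comp hor_tensA hor_tens1m hor_tensm1.

End HorizontalCategory.

(* XCirc X = X°, XBul X = X•, XTimes U = U^×, XPlus U = U^+ *)
Inductive exch_term (A0 : Type) : Type :=
| XUnit
| XTens of exch_term A0 & exch_term A0
| XCirc of A0
| XBul of A0
| XProd of exch_term A0 & exch_term A0
| XSum of exch_term A0 & exch_term A0
| XTimes of exch_term A0
| XPlus of exch_term A0.
Arguments XUnit {A0}.

Inductive exch_eq (A0 : Type) : exch_term A0 -> exch_term A0 -> Prop :=
| exch_refl u : exch_eq u u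
| exch_sym u v : exch_eq u v -> exch_eq v u
| exch_trans u v w : exch_eq u v -> exch_eq v w -> exch_eq u w
| exch_tens u u' v v' : exch_eq u u' -> exch_eq v v' ->
    exch_eq (XTens u v) (XTens u' v')
| exch_prod u u' v v' : exch_eq u u' -> exch_eq v v' ->
    exch_eq (XProd u v) (XProd u' v')
| exch_sum u u' v v' : exch_eq u u' -> exch_eq v v' ->
    exch_eq (XSum u v) (XSum u' v')
| exch_times u u' : exch_eq u u' -> exch_eq (XTimes u) (XTimes u')
| exch_plus u u' : exch_eq u u' -> exch_eq (XPlus u) (XPlus u')
| exch_tensA u v w : exch_eq (XTens u (XTens v w)) (XTens (XTens u v) w)
| exch_tens1x u : exch_eq (XTens XUnit u) u
| exch_tensx1 u : exch_eq (XTens u XUnit) u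
| exch_timesE u : exch_eq (XTimes u) (XProd XUnit (XTens u (XTimes u)))
| exch_plusE u : exch_eq (XPlus u) (XSum XUnit (XTens u (XPlus u))).

HB.instance Definition _ (A0 : Type) := gen_eqMixin (exch_term A0).
HB.instance Definition _ (A0 : Type) := gen_choiceMixin (exch_term A0).

Section Exchange.
Variable A0 : Type.

Definition exch_eqb : rel (exch_term A0) := fun u v => `[< exch_eq u v >].

Lemma exch_eqb_refl : reflexive exch_eqb.
Proof. by move=> u; apply/asboolP/exch_refl. Qed.

Lemma exch_eqb_sym : symmetric exch_eqb.
Proof. by move=> u v; apply/asboolP/asboolP => /exch_sym. Qed.

Lemma exch_eqb_trans : transitive exch_eqb.
Proof.
by move=> v u w /asboolP uv /asboolP vw; apply/asboolP; exact: exch_trans vw.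
Qed.

Canonical exch_equiv := EquivRel exch_eqb exch_eqb_refl exch_eqb_sym exch_eqb_trans.

Definition exchange : Type := {eq_quot exch_equiv}.
HB.instance Definition _ := Choice.on exchange.

Definition exch_class (u : exch_term A0) : exchange := \pi_({eq_quot exch_equiv}) u.
Definition exch_repr (U : exchange) : exch_term A0 :=
  repr (U : {eq_quot exch_equiv}).

Lemma exch_reprK U : exch_class (exch_repr U) = U.
Proof. exact: reprK. Qed.

Lemma exch_classP u v : exch_class u = exch_class v <-> exch_eq u v.
Proof.
split=> [/eqmodP/asboolP //|uv]; apply/eqmodP; exact/asboolP.
Qed.

Lemma repr_exch_class u : exch_eq (exch_repr (exch_class u)) u.
Proof. by apply/exch_classP; rewrite exch_reprK. Qed.

Definition xunit : exchange := exch_class XUnit.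
Definition xtens (U W : exchange) := exch_class (XTens (exch_repr U) (exch_repr W)).
Definition xcirc (X : A0) : exchange := exch_class (XCirc X).
Definition xbul (X : A0) : exchange := exch_class (XBul X).
Definition xprod (U W : exchange) := exch_class (XProd (exch_repr U) (exch_repr W)).
Definition xsum (U W : exchange) := exch_class (XSum (exch_repr U) (exch_repr W)).
Definition xtimes (U : exchange) := exch_class (XTimes (exch_repr U)).
Definition xplus (U : exchange) := exch_class (XPlus (exch_repr U)).

Lemma xtensA : associative xtens.
Proof.
move=> U W K; apply/exch_classP.
apply: exch_trans (exch_tens (exch_refl _) (repr_exch_class _)) _.
apply: exch_trans (exch_tensA _ _ _) _; apply: exch_sym.
exact: exch_tens (repr_exch_class _) (exch_refl _).
Qed.

Lemma xtens1x : left_id xunit xtens.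
Proof.
move=> U; rewrite -[RHS]exch_reprK; apply/exch_classP.
apply: exch_trans (exch_tens (repr_exch_class _) (exch_refl _)) _.
exact: exch_tens1x.
Qed.

Lemma xtensx1 : right_id xunit xtens.
Proof.
move=> U; rewrite -[RHS]exch_reprK; apply/exch_classP.
apply: exch_trans (exch_tens (exch_refl _) (repr_exch_class _)) _.
exact: exch_tensx1.
Qed.

HB.instance Definition _ := isMonoid.Build exchange xtensA xtens1x xtensx1.

Lemma xtimesE (U : exchange) : xtimes U = xprod 1 (U * xtimes U).
Proof.
apply/exch_classP; apply: exch_trans (exch_timesE _) _; apply: exch_sym.
apply: exch_prod; first exact: repr_exch_class.
apply: exch_trans (repr_exch_class _) _.
exact: exch_tens (exch_refl _) (repr_exch_class _).
Qed.

Lemma xplusE (U : exchange) : xplus U = xsum 1 (U * xplus U).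
Proof.
apply/exch_classP; apply: exch_trans (exch_plusE _) _; apply: exch_sym.
apply: exch_sum; first exact: repr_exch_class.
apply: exch_trans (repr_exch_class _) _.
exact: exch_tens (exch_refl _) (repr_exch_class _).
Qed.

End Exchange.

Section FreeCornering.
Variables (A0 : monoidType) (A : distributive_monoidal A0).

(* Formal cells, to be taken modulo [ceq]: the free double category on the given
   generators and equations is the term model.  Edges are already elements of the
   quotient monoid [exchange A0], not exchange terms. *)
Inductive cterm : exchange A0 -> A0 -> A0 -> exchange A0 -> Type :=
| t_hid U : cterm U 1 1 U
| t_vid X : cterm 1 X X 1
| t_hcomp U X Y V X' Y' W :
    cterm U X Y V -> cterm V X' Y' W -> cterm U (X * X') (Y * Y') W
| t_vcomp U X Z W U' Y W' :
    cterm U X Z W -> cterm U' Z Y W' -> cterm (U * U') X Y (W * W')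
| t_arr X Y : hom A X Y -> cterm 1 X Y 1
| t_getL X : cterm (xcirc X) 1 X 1
| t_putR X : cterm 1 X 1 (xcirc X)
| t_getR X : cterm 1 1 X (xbul X)
| t_putL X : cterm (xbul X) X 1 1
| t_pi0 U W : cterm (xprod U W) 1 1 U
| t_pi1 U W : cterm (xprod U W) 1 1 W
| t_prod V X Y U W : cterm V X Y U -> cterm V X Y W -> cterm V X Y (xprod U W)
| t_iota0 U W : cterm U 1 1 (xsum U W)
| t_iota1 U W : cterm W 1 1 (xsum U W)
| t_sum U W X Y V : cterm U X Y V -> cterm W X Y V -> cterm (xsum U W) X Y V
| t_copair U X X' Y W :
    cterm U X Y W -> cterm U X' Y W -> cterm U (oplus (d := A) X X') Y W
| t_times V X U W Y K :
    cterm V X X U -> cterm W X Y K -> cterm W 1 1 (V * W) ->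
    cterm W X Y (xtimes U * K)
| t_plus U X V K Y W :
    cterm U X X V -> cterm K X Y W -> cterm (V * W) 1 1 W ->
    cterm (xplus U * K) X Y W.

(* Projections of U^x = 1 x (U * U^x) and injections of U^+ = 1 + (U * U^+). *)
Definition t_pi0x U : cterm (xtimes U) 1 1 1 :=
  bcast cterm (esym (xtimesE U)) erefl erefl erefl (t_pi0 1 (U * xtimes U)).
Definition t_pi1x U : cterm (xtimes U) 1 1 (U * xtimes U) :=
  bcast cterm (esym (xtimesE U)) erefl erefl erefl (t_pi1 1 (U * xtimes U)).
Definition t_iota0x U : cterm 1 1 1 (xplus U) :=
  bcast cterm erefl erefl erefl (esym (xplusE U)) (t_iota0 1 (U * xplus U)).
Definition t_iota1x U : cterm (U * xplus U) 1 1 (xplus U) :=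
  bcast cterm erefl erefl erefl (esym (xplusE U)) (t_iota1 1 (U * xplus U)).

Local Notation "a <|> b" := (t_hcomp a b).
Local Notation "a </> b" := (t_vcomp a b).
Reserved Notation "a ~~ b" (at level 70, no associativity).

(* Equality of cells of the free cornering.  The boundaries of related terms are
   always equal (lemma [ceq_bnd]), though usually not convertibly so.  Congruence
   is only postulated for the two compositions: for the operations with a
   universal property it follows from the uniqueness rules ([t_prod_cong], ...). *)
Inductive ceq : forall U X Y W U' X' Y' W',
    cterm U X Y W -> cterm U' X' Y' W' -> Prop :=
| ceq_refl U X Y W (a : cterm U X Y W) : a ~~ a
| ceq_sym U X Y W U' X' Y' W' (a : cterm U X Y W) (b : cterm U' X' Y' W') :
    a ~~ b -> b ~~ a
| ceq_trans U X Y W U' X' Y' W' U2 X2 Y2 W2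
    (a : cterm U X Y W) (b : cterm U' X' Y' W') (c : cterm U2 X2 Y2 W2) :
    a ~~ b -> b ~~ c -> a ~~ c
| ceq_hcomp U X Y W X' Y' K U2 X2 Y2 W2 X2' Y2' K2
    (a : cterm U X Y W) (b : cterm W X' Y' K)
    (a' : cterm U2 X2 Y2 W2) (b' : cterm W2 X2' Y2' K2) :
    a ~~ a' -> b ~~ b' -> a <|> b ~~ a' <|> b'
| ceq_vcomp U X Z W U' Y W' U2 X2 Z2 W2 U2' Y2 W2'
    (a : cterm U X Z W) (b : cterm U' Z Y W')
    (a' : cterm U2 X2 Z2 W2) (b' : cterm U2' Z2 Y2 W2') :
    a ~~ a' -> b ~~ b' -> a </> b ~~ a' </> b'
| ceq_hcompA U0 U1 U2 U3 X Y X' Y' X2 Y2 (a : cterm U0 X Y U1)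
    (b : cterm U1 X' Y' U2) (c : cterm U2 X2 Y2 U3) :
    a <|> (b <|> c) ~~ (a <|> b) <|> c
| ceq_hcomp1c U X Y W (a : cterm U X Y W) : t_hid U <|> a ~~ a
| ceq_hcompc1 U X Y W (a : cterm U X Y W) : a <|> t_hid W ~~ a
| ceq_vcompA X0 X1 X2 X3 U W U' W' U2 W2 (a : cterm U X0 X1 W)
    (b : cterm U' X1 X2 W') (c : cterm U2 X2 X3 W2) :
    a </> (b </> c) ~~ (a </> b) </> c
| ceq_vcomp1c U X Y W (a : cterm U X Y W) : t_vid X </> a ~~ a
| ceq_vcompc1 U X Y W (a : cterm U X Y W) : a </> t_vid Y ~~ a
| ceq_hid1 : t_hid 1 ~~ t_vid 1
| ceq_vidM X Y : t_vid (X * Y) ~~ t_vid X <|> t_vid Y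
| ceq_hidM U W : t_hid (U * W) ~~ t_hid U </> t_hid W
| ceq_interchange U V W X Z Y U' V' W' X' Z' Y'
    (a : cterm U X Z V) (b : cterm U' Z Y V')
    (c : cterm V X' Z' W) (d : cterm V' Z' Y' W') :
    (a </> b) <|> (c </> d) ~~ (a <|> c) </> (b <|> d)
| ceq_arr_comp X Y Z (f : hom A X Y) (g : hom A Y Z) :
    t_arr (f \; g) ~~ t_arr f </> t_arr g
| ceq_arr_id X : t_arr (idm X) ~~ t_vid X
| ceq_arr_tens X Y X' Y' (f : hom A X Y) (g : hom A X' Y') :
    t_arr (tens f g) ~~ t_arr f <|> t_arr g
| ceq_putR_getL_h X : t_putR X <|> t_getL X ~~ t_vid X
| ceq_getL_putR_v X : t_getL X </> t_putR X ~~ t_hid (xcirc X)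
| ceq_getR_putL_h X : t_getR X <|> t_putL X ~~ t_vid X
| ceq_getR_putL_v X : t_getR X </> t_putL X ~~ t_hid (xbul X)
| ceq_prod_pi0 V X Y U W (a : cterm V X Y U) (b : cterm V X Y W) :
    t_prod a b <|> t_pi0 U W ~~ a
| ceq_prod_pi1 V X Y U W (a : cterm V X Y U) (b : cterm V X Y W) :
    t_prod a b <|> t_pi1 U W ~~ b
| ceq_prod_uniq V X Y U W (a : cterm V X Y U) (b : cterm V X Y W)
    (c : cterm V X Y (xprod U W)) :
    c <|> t_pi0 U W ~~ a -> c <|> t_pi1 U W ~~ b -> c ~~ t_prod a b
| ceq_iota0_sum U W X Y V (a : cterm U X Y V) (b : cterm W X Y V) :
    t_iota0 U W <|> t_sum a b ~~ a
| ceq_iota1_sum U W X Y V (a : cterm U X Y V) (b : cterm W X Y V) :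
    t_iota1 U W <|> t_sum a b ~~ b
| ceq_sum_uniq U W X Y V (a : cterm U X Y V) (b : cterm W X Y V)
    (c : cterm (xsum U W) X Y V) :
    t_iota0 U W <|> c ~~ a -> t_iota1 U W <|> c ~~ b -> c ~~ t_sum a b
| ceq_inj0_copair U X X' Y W (a : cterm U X Y W) (b : cterm U X' Y W) :
    t_arr (inj0 X X') </> t_copair a b ~~ a
| ceq_inj1_copair U X X' Y W (a : cterm U X Y W) (b : cterm U X' Y W) :
    t_arr (inj1 X X') </> t_copair a b ~~ b
| ceq_copair_uniq U X X' Y W (a : cterm U X Y W) (b : cterm U X' Y W)
    (c : cterm U (oplus X X') Y W) :
    t_arr (inj0 X X') </> c ~~ a -> t_arr (inj1 X X') </> c ~~ b ->
    c ~~ t_copair a b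
| ceq_times_pi0 V X U W Y K (a : cterm V X X U) (f : cterm W X Y K)
    (g : cterm W 1 1 (V * W)) :
    t_times a f g <|> (t_pi0x U </> t_hid K) ~~ f
| ceq_times_pi1 V X U W Y K (a : cterm V X X U) (f : cterm W X Y K)
    (g : cterm W 1 1 (V * W)) :
    t_times a f g <|> (t_pi1x U </> t_hid K) ~~ g <|> (a </> t_times a f g)
| ceq_times_uniq V X U W Y K (a : cterm V X X U) (f : cterm W X Y K)
    (g : cterm W 1 1 (V * W)) (c : cterm W X Y (xtimes U * K)) :
    c <|> (t_pi0x U </> t_hid K) ~~ f ->
    c <|> (t_pi1x U </> t_hid K) ~~ g <|> (a </> c) ->
    c ~~ t_times a f g
| ceq_iota0_plus U X V K Y W (a : cterm U X X V) (f : cterm K X Y W)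
    (g : cterm (V * W) 1 1 W) :
    (t_iota0x U </> t_hid K) <|> t_plus a f g ~~ f
| ceq_iota1_plus U X V K Y W (a : cterm U X X V) (f : cterm K X Y W)
    (g : cterm (V * W) 1 1 W) :
    (t_iota1x U </> t_hid K) <|> t_plus a f g ~~ (a </> t_plus a f g) <|> g
| ceq_plus_uniq U X V K Y W (a : cterm U X X V) (f : cterm K X Y W)
    (g : cterm (V * W) 1 1 W) (c : cterm (xplus U * K) X Y W) :
    (t_iota0x U </> t_hid K) <|> c ~~ f ->
    (t_iota1x U </> t_hid K) <|> c ~~ (a </> c) <|> g ->
    c ~~ t_plus a f g
where "a ~~ b" := (ceq a b).

Lemma t_prod_cong V X Y U W (a a' : cterm V X Y U) (b b' : cterm V X Y W) :
  a ~~ a' -> b ~~ b' -> t_prod a b ~~ t_prod a' b'.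
Proof.
move=> aa bb; apply: ceq_prod_uniq.
  exact: ceq_trans (ceq_prod_pi0 _ _) aa.
exact: ceq_trans (ceq_prod_pi1 _ _) bb.
Qed.

Lemma t_sum_cong U W X Y V (a a' : cterm U X Y V) (b b' : cterm W X Y V) :
  a ~~ a' -> b ~~ b' -> t_sum a b ~~ t_sum a' b'.
Proof.
move=> aa bb; apply: ceq_sum_uniq.
  exact: ceq_trans (ceq_iota0_sum _ _) aa.
exact: ceq_trans (ceq_iota1_sum _ _) bb.
Qed.

Lemma t_copair_cong U X X' Y W (a a' : cterm U X Y W) (b b' : cterm U X' Y W) :
  a ~~ a' -> b ~~ b' -> t_copair a b ~~ t_copair a' b'.
Proof.
move=> aa bb; apply: ceq_copair_uniq.
  exact: ceq_trans (ceq_inj0_copair _ _) aa.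
exact: ceq_trans (ceq_inj1_copair _ _) bb.
Qed.

Lemma t_times_cong V X U W Y K (a a' : cterm V X X U) (f f' : cterm W X Y K)
    (g g' : cterm W 1 1 (V * W)) :
  a ~~ a' -> f ~~ f' -> g ~~ g' -> t_times a f g ~~ t_times a' f' g'.
Proof.
move=> aa ff gg; apply: ceq_times_uniq.
  exact: ceq_trans (ceq_times_pi0 _ _ _) ff.
apply: ceq_trans (ceq_times_pi1 _ _ _) _.
exact: ceq_hcomp gg (ceq_vcomp aa (ceq_refl _)).
Qed.

Lemma t_plus_cong U X V K Y W (a a' : cterm U X X V) (f f' : cterm K X Y W)
    (g g' : cterm (V * W) 1 1 W) :
  a ~~ a' -> f ~~ f' -> g ~~ g' -> t_plus a f g ~~ t_plus a' f' g'.
Proof.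
move=> aa ff gg; apply: ceq_plus_uniq.
  exact: ceq_trans (ceq_iota0_plus _ _ _) ff.
apply: ceq_trans (ceq_iota1_plus _ _ _) _.
exact: ceq_hcomp (ceq_vcomp aa (ceq_refl _)) gg.
Qed.

Lemma ceq_bnd U X Y W U' X' Y' W' (a : cterm U X Y W) (b : cterm U' X' Y' W') :
  a ~~ b -> [/\ U = U', X = X', Y = Y' & W = W'].
Proof.
elim=> //=; intros; rewrite ?mulg1 ?mul1g ?mulgA //;
  repeat match goal with h : [/\ _, _, _ & _] |- _ => case: h => * end;
  by split; congruence.
Qed.

HB.instance Definition _ U X Y W := gen_eqMixin (cterm U X Y W).
HB.instance Definition _ U X Y W := gen_choiceMixin (cterm U X Y W).

Section FixedBoundary.
Variables (U : exchange A0) (X Y : A0) (W : exchange A0).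

Definition ceqb : rel (cterm U X Y W) := fun a b => `[< a ~~ b >].

Lemma ceqb_refl : reflexive ceqb.
Proof. by move=> a; apply/asboolP/ceq_refl. Qed.

Lemma ceqb_sym : symmetric ceqb.
Proof. by move=> a b; apply/asboolP/asboolP => /ceq_sym. Qed.

Lemma ceqb_trans : transitive ceqb.
Proof.
by move=> b a c /asboolP ab /asboolP bc; apply/asboolP; exact: ceq_trans bc.
Qed.

Canonical ceq_equiv := EquivRel ceqb ceqb_refl ceqb_sym ceqb_trans.

Definition fcell : Type := {eq_quot ceq_equiv}.

Definition cclass (a : cterm U X Y W) : fcell := \pi_({eq_quot ceq_equiv}) a.
Definition crepr (c : fcell) : cterm U X Y W := repr (c : {eq_quot ceq_equiv}).

Lemma creprK c : cclass (crepr c) = c.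
Proof. exact: reprK. Qed.

Lemma cclassP a b : cclass a = cclass b <-> a ~~ b.
Proof. by split=> [/eqmodP/asboolP //|ab]; apply/eqmodP; exact/asboolP. Qed.

Lemma crepr_class a : crepr (cclass a) ~~ a.
Proof. by apply/cclassP; rewrite creprK. Qed.

End FixedBoundary.

Lemma cclass_beq U X Y W U' X' Y' W' (a : cterm U X Y W) (b : cterm U' X' Y' W') :
  beq fcell (cclass a) (cclass b) <-> a ~~ b.
Proof.
split=> [[eU [eX [eY [eW]]]]|ab].
  by case: _ / eU b; case: _ / eX; case: _ / eY; case: _ / eW => b /cclassP.
have [eU eX eY eW] := ceq_bnd ab.
move: b ab; case: _ / eU; case: _ / eX; case: _ / eY; case: _ / eW => b.
by move=> /cclassP ->; exact: beq_refl.
Qed.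

Definition c_hid U : fcell U 1 1 U := cclass (t_hid U).
Definition c_vid X : fcell 1 X X 1 := cclass (t_vid X).
Definition c_hcomp U X Y V X' Y' W (a : fcell U X Y V) (b : fcell V X' Y' W) :
  fcell U (X * X') (Y * Y') W := cclass (crepr a <|> crepr b).
Definition c_vcomp U X Z W U' Y W' (a : fcell U X Z W) (b : fcell U' Z Y W') :
  fcell (U * U') X Y (W * W') := cclass (crepr a </> crepr b).

Lemma cclass_hcomp U X Y V X' Y' W (a : cterm U X Y V) (b : cterm V X' Y' W) :
  c_hcomp (cclass a) (cclass b) = cclass (a <|> b).
Proof. by apply/cclassP/ceq_hcomp; exact: crepr_class. Qed.

Lemma cclass_vcomp U X Z W U' Y W' (a : cterm U X Z W) (b : cterm U' Z Y W') :
  c_vcomp (cclass a) (cclass b) = cclass (a </> b).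
Proof. by apply/cclassP/ceq_vcomp; exact: crepr_class. Qed.

Definition free_cornering : double_category A0 (exchange A0).
Proof.
refine (@DoubleCategory A0 (exchange A0) fcell c_hid c_vid c_hcomp c_vcomp
  _ _ _ _ _ _ _ _ _ _).
- move=> U0 U1 U2 U3 X Y X' Y' X2 Y2 a b c.
  rewrite -[a]creprK -[b]creprK -[c]creprK !cclass_hcomp.
  exact/cclass_beq/ceq_hcompA.
- move=> U X Y W a; rewrite -[a]creprK cclass_hcomp.
  exact/cclass_beq/ceq_hcomp1c.
- move=> U X Y W a; rewrite -[a]creprK cclass_hcomp.
  exact/cclass_beq/ceq_hcompc1.
- move=> X0 X1 X2 X3 U W U' W' U2 W2 a b c.
  rewrite -[a]creprK -[b]creprK -[c]creprK !cclass_vcomp.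
  exact/cclass_beq/ceq_vcompA.
- move=> U X Y W a; rewrite -[a]creprK cclass_vcomp.
  exact/cclass_beq/ceq_vcomp1c.
- move=> U X Y W a; rewrite -[a]creprK cclass_vcomp.
  exact/cclass_beq/ceq_vcompc1.
- exact/cclassP/ceq_hid1.
- by move=> X Y; rewrite cclass_hcomp; apply/cclassP/ceq_vidM.
- by move=> U W; rewrite cclass_vcomp; apply/cclassP/ceq_hidM.
- move=> U V W X Z Y U' V' W' X' Z' Y' a b c d.
  rewrite -[a]creprK -[b]creprK -[c]creprK -[d]creprK.
  rewrite !(cclass_vcomp, cclass_hcomp); exact/cclassP/ceq_interchange.
Defined.

Definition c_pi0 U W : fcell (xprod U W) 1 1 U := cclass (t_pi0 U W).
Definition c_pi1 U W : fcell (xprod U W) 1 1 W := cclass (t_pi1 U W).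
Definition c_prod V X Y U W (a : fcell V X Y U) (b : fcell V X Y W) :
  fcell V X Y (xprod U W) := cclass (t_prod (crepr a) (crepr b)).
Definition c_iota0 U W : fcell U 1 1 (xsum U W) := cclass (t_iota0 U W).
Definition c_iota1 U W : fcell W 1 1 (xsum U W) := cclass (t_iota1 U W).
Definition c_sum U W X Y V (a : fcell U X Y V) (b : fcell W X Y V) :
  fcell (xsum U W) X Y V := cclass (t_sum (crepr a) (crepr b)).

Lemma c_prod_pi0 V X Y U W (a : fcell V X Y U) (b : fcell V X Y W) :
  beq fcell (c_hcomp (c_prod a b) (c_pi0 U W)) a.
Proof.
have /cclass_beq := ceq_prod_pi0 (crepr a) (crepr b).
by rewrite creprK -cclass_hcomp.
Qed.

Lemma c_prod_pi1 V X Y U W (a : fcell V X Y U) (b : fcell V X Y W) :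
  beq fcell (c_hcomp (c_prod a b) (c_pi1 U W)) b.
Proof.
have /cclass_beq := ceq_prod_pi1 (crepr a) (crepr b).
by rewrite creprK -cclass_hcomp.
Qed.

Lemma c_prod_uniq V X Y U W (a : fcell V X Y U) (b : fcell V X Y W)
    (c : fcell V X Y (xprod U W)) :
  beq fcell (c_hcomp c (c_pi0 U W)) a -> beq fcell (c_hcomp c (c_pi1 U W)) b ->
  c = c_prod a b.
Proof.
rewrite -[c]creprK !cclass_hcomp -{1}[a]creprK -{1}[b]creprK.
by move=> /cclass_beq ca /cclass_beq cb; apply/cclassP; exact: ceq_prod_uniq.
Qed.

Lemma c_iota0_sum U W X Y V (a : fcell U X Y V) (b : fcell W X Y V) :
  beq fcell (c_hcomp (c_iota0 U W) (c_sum a b)) a.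
Proof.
have /cclass_beq := ceq_iota0_sum (crepr a) (crepr b).
by rewrite creprK -cclass_hcomp.
Qed.

Lemma c_iota1_sum U W X Y V (a : fcell U X Y V) (b : fcell W X Y V) :
  beq fcell (c_hcomp (c_iota1 U W) (c_sum a b)) b.
Proof.
have /cclass_beq := ceq_iota1_sum (crepr a) (crepr b).
by rewrite creprK -cclass_hcomp.
Qed.

Lemma c_sum_uniq U W X Y V (a : fcell U X Y V) (b : fcell W X Y V)
    (c : fcell (xsum U W) X Y V) :
  beq fcell (c_hcomp (c_iota0 U W) c) a -> beq fcell (c_hcomp (c_iota1 U W) c) b ->
  c = c_sum a b.
Proof.
rewrite -[c]creprK !cclass_hcomp -{1}[a]creprK -{1}[b]creprK.
by move=> /cclass_beq ca /cclass_beq cb; apply/cclassP; exact: ceq_sum_uniq.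
Qed.

Local Notation HA := (horizontal free_cornering).

Section Functors.
Variable U : exchange A0.

Definition prod_fmap W W' (h : hom HA W W') :
    hom HA (xprod 1 (U * W)) (xprod 1 (U * W')) :=
  c_prod (c_pi0 1 (U * W))
    ((c_pi1 1 (U * W) : hom HA _ _) \; tens (idm U) h).

Definition sum_fmap W W' (h : hom HA W W') :
    hom HA (xsum 1 (U * W)) (xsum 1 (U * W')) :=
  c_sum (c_iota0 1 (U * W'))
    (tens (idm U) h \; (c_iota1 1 (U * W') : hom HA _ _)).

Lemma hom_prod_pi0 V W W' (a : hom HA V W) (b : hom HA V W') :
  (c_prod a b : hom HA _ _) \; c_pi0 W W' = a.
Proof.
apply: (@beq_eq _ _ fcell).
exact: (beq_trans (hor_compE (D := free_cornering) _ _) (c_prod_pi0 _ _)). Qed.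

Lemma hom_prod_pi1 V W W' (a : hom HA V W) (b : hom HA V W') :
  (c_prod a b : hom HA _ _) \; c_pi1 W W' = b.
Proof.
apply: (@beq_eq _ _ fcell).
exact: (beq_trans (hor_compE (D := free_cornering) _ _) (c_prod_pi1 _ _)). Qed.

Lemma hom_prod_uniq V W W' (a : hom HA V W) (b : hom HA V W')
    (c : hom HA V (xprod W W')) :
  c \; c_pi0 W W' = a -> c \; c_pi1 W W' = b -> c = c_prod a b.
Proof.
move=> <- <-; apply: c_prod_uniq;
  apply: beq_sym; exact: (hor_compE (D := free_cornering)).
Qed.

Lemma hom_iota0_sum V W W' (a : hom HA W V) (b : hom HA W' V) :
  (c_iota0 W W' : hom HA _ _) \; c_sum a b = a.
Proof.
apply: (@beq_eq _ _ fcell).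
exact: (beq_trans (hor_compE (D := free_cornering) _ _) (c_iota0_sum _ _)). Qed.

Lemma hom_iota1_sum V W W' (a : hom HA W V) (b : hom HA W' V) :
  (c_iota1 W W' : hom HA _ _) \; c_sum a b = b.
Proof.
apply: (@beq_eq _ _ fcell).
exact: (beq_trans (hor_compE (D := free_cornering) _ _) (c_iota1_sum _ _)). Qed.

Lemma hom_sum_uniq V W W' (a : hom HA W V) (b : hom HA W' V)
    (c : hom HA (xsum W W') V) :
  (c_iota0 W W' : hom HA _ _) \; c = a ->
  (c_iota1 W W' : hom HA _ _) \; c = b -> c = c_sum a b.
Proof.
move=> <- <-; apply: c_sum_uniq;
  apply: beq_sym; exact: (hor_compE (D := free_cornering)).
Qed.

Lemma prod_fmap_id W : prod_fmap (idm W) = idm (xprod 1 (U * W)).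
Proof.
apply/esym/hom_prod_uniq; first exact: mcomp1m.
by rewrite tens_id mcompm1 mcomp1m.
Qed.

Lemma prod_fmap_comp W W' K (h : hom HA W W') (k : hom HA W' K) :
  prod_fmap (h \; k) = prod_fmap h \; prod_fmap k.
Proof.
apply/esym/hom_prod_uniq; rewrite -mcompA.
  by rewrite hom_prod_pi0 hom_prod_pi0.
by rewrite hom_prod_pi1 mcompA hom_prod_pi1 -mcompA -tens_comp mcomp1m.
Qed.

Lemma sum_fmap_id W : sum_fmap (idm W) = idm (xsum 1 (U * W)).
Proof.
apply/esym/hom_sum_uniq; first exact: mcompm1.
by rewrite tens_id mcomp1m mcompm1.
Qed.

Lemma sum_fmap_comp W W' K (h : hom HA W W') (k : hom HA W' K) :
  sum_fmap (h \; k) = sum_fmap h \; sum_fmap k.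
Proof.
apply/esym/hom_sum_uniq; rewrite mcompA.
  by rewrite hom_iota0_sum hom_iota0_sum.
by rewrite hom_iota1_sum -mcompA hom_iota1_sum mcompA -tens_comp mcomp1m.
Qed.

Definition prod_functor : functor HA HA := Functor prod_fmap_id prod_fmap_comp.
Definition sum_functor : functor HA HA := Functor sum_fmap_id sum_fmap_comp.

End Functors.

End FreeCornering.

(* Main.v *)
Require Import Defs.
From mathcomp Require Import all_boot monoid.

(** The iteration cells with [K = 1] and a horizontal identity as iterated cell
    are the (co)recursors: for [f : W -> 1] and [g : W -> U * W], the equations
    characterising [(id_U)^x_{f,g}] say that it is the coalgebra map into [U^x]
    from the coalgebra [f x g] on [W], and every coalgebra on [W] has this form.
    The algebra case is dual.  Since equality of formal cells is heterogeneous,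
    the computations take place on representatives, where casts are invisible. *)

Set Implicit Arguments.
Unset Strict Implicit.
Unset Printing Implicit Defensive.

Local Open Scope group_scope.
Local Open Scope cat_scope.

Section Iteration.
Variables (A0 : monoidType) (A : distributive_monoidal A0).

Local Notation HA := (horizontal (free_cornering A)).
Local Notation "a ~~ b" := (ceq a b) (at level 70, no associativity).

(** * Transport and equality on representatives *)

Lemma ceq_bcast U X Y W U' X' Y' W' (eU : U = U') (eX : X = X') (eY : Y = Y')
    (eW : W = W') (a : cterm A U X Y W) :
  bcast (cterm A) eU eX eY eW a ~~ a.
Proof.
by case: _ / eU; case: _ / eX; case: _ / eY; case: _ / eW; exact: ceq_refl.
Qed.

(** Since [hid 1 = vid 1], the factor $id_K$ in the equations of the iteration cells disappears at
    $K = I$. *)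
Lemma ceq_vcomp_hid1 U X W (a : cterm A U X 1 W) :
  t_vcomp a (t_hid A 1) ~~ a.
Proof.
exact: ceq_trans (ceq_vcomp (ceq_refl _) (ceq_hid1 A)) (ceq_vcompc1 _).
Qed.

Lemma hom_eqP V W (f g : hom HA V W) : f = g <-> crepr f ~~ crepr g.
Proof. by rewrite -cclassP !creprK. Qed.

Lemma crepr_cast U X Y W U' X' Y' W' (eU : U = U') (eX : X = X') (eY : Y = Y')
    (eW : W = W') (a : fcell A U X Y W) :
  crepr (bcast (fcell A) eU eX eY eW a) ~~ crepr a.
Proof.
by case: _ / eU; case: _ / eX; case: _ / eY; case: _ / eW; exact: ceq_refl.
Qed.

Lemma crepr_comp V W K (f : hom HA V W) (g : hom HA W K) :
  crepr (f \; g) ~~ t_hcomp (crepr f) (crepr g).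
Proof. exact: ceq_trans (crepr_cast _ _ _ _ _) (crepr_class _). Qed.

Lemma crepr_tens V W V' W' (f : hom HA V W) (g : hom HA V' W') :
  crepr (tens f g) ~~ t_vcomp (crepr f) (crepr g).
Proof. exact: crepr_class. Qed.

Lemma crepr_eq_hom V W (e : V = W) : crepr (eq_hom HA e) ~~ t_hid A V.
Proof. by case: _ / e; exact: crepr_class. Qed.

(** Once [e] is eliminated, [eq_hom] is an identity: composing with it only renames a boundary,
    which [ceq] does not see. *)
Lemma comp_eq_homE V W K (e : V = W) (f : hom HA W K) (a : cterm A V 1 1 K) :
  a ~~ crepr f -> crepr (eq_hom HA e \; f) ~~ a.
Proof.
case: _ / e f => f af; rewrite mcomp1m.
exact: ceq_sym.
Qed.

Lemma eq_hom_compE V W K (e : W = K) (f : hom HA V W) (a : cterm A V 1 1 K) :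
  a ~~ crepr f -> crepr (f \; eq_hom HA e) ~~ a.
Proof.
case: _ / e a => a af; rewrite mcompm1.
exact: ceq_sym.
Qed.

(** * Corecursion into $U^\times$ and finality *)

Section Times.
Variable U : exchange A0.

(** With [out1], the two components of the coalgebra structure on $U^\times$; these are the arrows
    behind [t_pi0x] and [t_pi1x]. *)
Definition out0 : hom HA (xtimes U) 1 :=
  eq_hom HA (xtimesE U) \; c_pi0 A 1 (U * xtimes U).
Definition out1 : hom HA (xtimes U) (U * xtimes U) :=
  eq_hom HA (xtimesE U) \; c_pi1 A 1 (U * xtimes U).

Lemma crepr_out0 : t_vcomp (t_pi0x A U) (t_hid A 1) ~~ crepr out0.
Proof.
apply: ceq_trans (ceq_vcomp_hid1 _) _; apply: ceq_sym; apply: comp_eq_homE.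
exact: ceq_trans (ceq_bcast _ _ _ _ _) (ceq_sym (crepr_class _)).
Qed.

Lemma crepr_out1 : t_vcomp (t_pi1x A U) (t_hid A 1) ~~ crepr out1.
Proof.
apply: ceq_trans (ceq_vcomp_hid1 _) _; apply: ceq_sym; apply: comp_eq_homE.
exact: ceq_trans (ceq_bcast _ _ _ _ _) (ceq_sym (crepr_class _)).
Qed.

(** Identifies the right-hand side of [ceq_times_pi1], for the iterated cell $id_U$, with an arrow
    of the horizontal category. The cell [c] is kept apart from [h] because its right boundary
    carries an extra factor [1]. *)
Lemma crepr_corec_step W (g : hom HA W (U * W)) (h : hom HA W (xtimes U))
    (c : cterm A W 1 1 (xtimes U * 1)) : c ~~ crepr h ->
  t_hcomp (crepr g) (t_vcomp (t_hid A U) c) ~~ crepr (g \; tens (idm U) h).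
Proof.
move=> ch; apply: ceq_sym; apply: ceq_trans (crepr_comp _ _) _.
apply: ceq_hcomp (ceq_refl _) _; apply: ceq_trans (crepr_tens _ _) _.
exact: ceq_vcomp (crepr_class _) (ceq_sym ch).
Qed.

Lemma times_corec W (f : hom HA W 1) (g : hom HA W (U * W)) :
  exists! h : hom HA W (xtimes U),
    h \; out0 = f /\ h \; out1 = g \; tens (idm U) h.
Proof.
pose c := t_times (t_hid A U) (crepr f) (crepr g).
(* The iteration cell ends in $U^\times\otimes I$; the cast removes the unit. *)
pose h : hom HA W (xtimes U) :=
  cclass (bcast (cterm A) erefl erefl erefl (mulg1 (xtimes U)) c).
have ch : c ~~ crepr h.
  by apply: ceq_sym; exact: ceq_trans (crepr_class _) (ceq_bcast _ _ _ _ _).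
exists h; split=> [|k [kf kg]].
  split; apply/hom_eqP; apply: ceq_trans (crepr_comp _ _) _.
    apply: ceq_trans (ceq_hcomp (ceq_sym ch) (ceq_sym crepr_out0)) _.
    exact: ceq_times_pi0.
  apply: ceq_trans (ceq_hcomp (ceq_sym ch) (ceq_sym crepr_out1)) _.
  exact: ceq_trans (ceq_times_pi1 _ _ _) (crepr_corec_step _ ch).
(* The unit is put back, since [ceq_times_uniq] expects the boundary $U^\times\otimes K$. *)
pose c' := bcast (cterm A) erefl erefl erefl (esym (mulg1 (xtimes U))) (crepr k).
have ck : c' ~~ crepr k by exact: ceq_bcast.
apply/hom_eqP; apply: ceq_trans (ceq_sym ch) _; apply: ceq_sym.
apply: ceq_trans (ceq_sym ck) _; apply: ceq_times_uniq.
  apply: ceq_trans (ceq_hcomp ck crepr_out0) _.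
  by apply: ceq_trans (ceq_sym (crepr_comp _ _)) _; apply/hom_eqP.
apply: ceq_trans (ceq_hcomp ck crepr_out1) _.
apply: ceq_trans (ceq_sym (crepr_comp _ _)) _; rewrite kg.
exact: ceq_sym (crepr_corec_step _ ck).
Qed.

Lemma fmap_pi0 W W' (h : hom HA W W') :
  fmap (prod_functor A U) h \; c_pi0 A 1 (U * W') = c_pi0 A 1 (U * W).
Proof. exact: hom_prod_pi0. Qed.

Lemma fmap_pi1 W W' (h : hom HA W W') :
  fmap (prod_functor A U) h \; c_pi1 A 1 (U * W') =
  (c_pi1 A 1 (U * W) : hom HA _ _) \; tens (idm U) h.
Proof. exact: hom_prod_pi1. Qed.

(** Arrows into $I\times(U\otimes U^\times)$ are determined by their projections, so the coalgebra
    square for [b] amounts to the two equations of [times_corec] for the components of [b]. *)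
Lemma final_coalgebra_times :
  is_final_coalgebra (F := prod_functor A U) (eq_hom HA (xtimesE U)).
Proof.
move=> W b.
have [h [[h0 h1] huniq]] :=
  times_corec (b \; c_pi0 A 1 (U * W)) (b \; c_pi1 A 1 (U * W)).
exists h; split=> [|k kE].
  rewrite /out0 mcompA in h0; rewrite /out1 mcompA in h1.
  (* Both sides of the square are shown to be the same pairing. *)
  rewrite [LHS](hom_prod_uniq h0 h1).
  apply/esym/hom_prod_uniq; rewrite -!mcompA.
    by rewrite fmap_pi0.
  by rewrite fmap_pi1.
(* Conversely, projecting the square for [k] gives the two corecursion equations. *)
apply: huniq; rewrite /out0 /out1 !mcompA kE -!mcompA.
by rewrite fmap_pi0 fmap_pi1.
Qed.

End Times.

(** * Recursion out of $U^+$ and initiality *)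

Section Plus.
Variable U : exchange A0.

Definition in0 : hom HA 1 (xplus U) :=
  (c_iota0 A 1 (U * xplus U) : hom HA _ _) \; eq_hom HA (esym (xplusE U)).
Definition in1 : hom HA (U * xplus U) (xplus U) :=
  (c_iota1 A 1 (U * xplus U) : hom HA _ _) \; eq_hom HA (esym (xplusE U)).

Lemma crepr_in0 : t_vcomp (t_iota0x A U) (t_hid A 1) ~~ crepr in0.
Proof.
apply: ceq_trans (ceq_vcomp_hid1 _) _; apply: ceq_sym; apply: eq_hom_compE.
exact: ceq_trans (ceq_bcast _ _ _ _ _) (ceq_sym (crepr_class _)).
Qed.

Lemma crepr_in1 : t_vcomp (t_iota1x A U) (t_hid A 1) ~~ crepr in1.
Proof.
apply: ceq_trans (ceq_vcomp_hid1 _) _; apply: ceq_sym; apply: eq_hom_compE.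
exact: ceq_trans (ceq_bcast _ _ _ _ _) (ceq_sym (crepr_class _)).
Qed.

Lemma crepr_rec_step W (g : hom HA (U * W) W) (h : hom HA (xplus U) W)
    (c : cterm A (xplus U * 1) 1 1 W) : c ~~ crepr h ->
  t_hcomp (t_vcomp (t_hid A U) c) (crepr g) ~~ crepr (tens (idm U) h \; g).
Proof.
move=> ch; apply: ceq_sym; apply: ceq_trans (crepr_comp _ _) _.
apply: ceq_hcomp _ (ceq_refl _); apply: ceq_trans (crepr_tens _ _) _.
exact: ceq_vcomp (crepr_class _) (ceq_sym ch).
Qed.

Lemma plus_rec W (f : hom HA 1 W) (g : hom HA (U * W) W) :
  exists! h : hom HA (xplus U) W,
    in0 \; h = f /\ in1 \; h = tens (idm U) h \; g.
Proof.
pose c := t_plus (t_hid A U) (crepr f) (crepr g).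
(* Dually to the product case, the extra unit now sits in the left boundary $U^+\otimes I$. *)
pose h : hom HA (xplus U) W :=
  cclass (bcast (cterm A) (mulg1 (xplus U)) erefl erefl erefl c).
have ch : c ~~ crepr h.
  by apply: ceq_sym; exact: ceq_trans (crepr_class _) (ceq_bcast _ _ _ _ _).
exists h; split=> [|k [kf kg]].
  split; apply/hom_eqP; apply: ceq_trans (crepr_comp _ _) _.
    apply: ceq_trans (ceq_hcomp (ceq_sym crepr_in0) (ceq_sym ch)) _.
    exact: ceq_iota0_plus.
  apply: ceq_trans (ceq_hcomp (ceq_sym crepr_in1) (ceq_sym ch)) _.
  exact: ceq_trans (ceq_iota1_plus _ _ _) (crepr_rec_step _ ch).
pose c' := bcast (cterm A) (esym (mulg1 (xplus U))) erefl erefl erefl (crepr k).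
have ck : c' ~~ crepr k by exact: ceq_bcast.
apply/hom_eqP; apply: ceq_trans (ceq_sym ch) _; apply: ceq_sym.
apply: ceq_trans (ceq_sym ck) _; apply: ceq_plus_uniq.
  apply: ceq_trans (ceq_hcomp crepr_in0 ck) _.
  by apply: ceq_trans (ceq_sym (crepr_comp _ _)) _; apply/hom_eqP.
apply: ceq_trans (ceq_hcomp crepr_in1 ck) _.
apply: ceq_trans (ceq_sym (crepr_comp _ _)) _; rewrite kg.
exact: ceq_sym (crepr_rec_step _ ck).
Qed.

Lemma iota0_fmap W W' (h : hom HA W W') :
  (c_iota0 A 1 (U * W) : hom HA _ _) \; fmap (sum_functor A U) h =
  c_iota0 A 1 (U * W').
Proof. exact: hom_iota0_sum. Qed.

Lemma iota1_fmap W W' (h : hom HA W W') :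
  (c_iota1 A 1 (U * W) : hom HA _ _) \; fmap (sum_functor A U) h =
  tens (idm U) h \; (c_iota1 A 1 (U * W') : hom HA _ _).
Proof. exact: hom_iota1_sum. Qed.

(** Arrows out of $I+(U\otimes U^+)$ are determined by their restrictions along the injections, so
    the algebra square splits into the two equations of [plus_rec]. *)
Lemma initial_algebra_plus :
  is_initial_algebra (F := sum_functor A U) (eq_hom HA (esym (xplusE U))).
Proof.
move=> W b.
have [h [[h0 h1] huniq]] :=
  plus_rec ((c_iota0 A 1 (U * W) : hom HA _ _) \; b)
           ((c_iota1 A 1 (U * W) : hom HA _ _) \; b).
exists h; split=> [|k kE].
  rewrite /in0 -mcompA in h0; rewrite /in1 -mcompA in h1.
  rewrite [LHS](hom_sum_uniq h0 h1).
  apply/esym/hom_sum_uniq; rewrite !mcompA.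
    by rewrite iota0_fmap.
  by rewrite iota1_fmap.
apply: huniq; rewrite /in0 /in1 -!mcompA kE !mcompA.
by rewrite iota0_fmap iota1_fmap.
Qed.

End Plus.
End Iteration.

Theorem lemma17 (A0 : monoidType) (A : distributive_monoidal A0)
    (U : exchange A0) :
  is_final_coalgebra (F := prod_functor A U) (X := xtimes U)
    (eq_hom (horizontal (free_cornering A)) (xtimesE U)) /\
  is_initial_algebra (F := sum_functor A U) (X := xplus U)
    (eq_hom (horizontal (free_cornering A)) (esym (xplusE U))).
Proof. by split; [exact: final_coalgebra_times | exact: initial_algebra_plus]. Qed.
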